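(* Let $\mathcal M\subset\mathbb R^n$ be a closed smooth $d$-dimensional submanifold, $X=\{\mathbf x_1,\dots,\mathbf x_N\}\subset\mathcal M$, $\epsilon>0$, and let $\tilde k_\epsilon$ be the Gaussian kernel and $k_{\epsilon,N}$ the Diffusion Maps kernel on $\mathcal M$ (defined in the context). Assume that $$\phi(\mathbf x)=\frac{1}{q_{\epsilon,N}(\mathbf x)\sqrt{\hat q_{\epsilon,N}(\mathbf x)}}\ne0\qquad\text{for all }\mathbf x\in\mathcal M.$$ Then the kernel $k_{\epsilon,N}$ is symmetric positive definite (i.e. symmetric with $\sum_{i,j}a_ia_jk_{\epsilon,N}(\mathbf z_i,\mathbf z_j)\ge0$ for all finite families $a_i\in\mathbb R$, $\mathbf z_i\in\mathcal M$). Moreover, the RKHS induced by $k_{\epsilon,N}$ is $$\mathcal H_{\epsilon,N}=\left\{Uf:=\phi f:\ f\in\mathcal H_{\tilde k_\epsilon}\right\},$$ and it is isometrically isomorphic (via $U$) to the RKHS $\mathcal H_{\tilde k_\epsilon}$ induced by $\tilde k_\epsilon$ on $\mathcal M$; that is, $\|\phi f\|_{\mathcal H_{\epsilon,N}}=\|f\|_{\mathcal H_{\tilde k_\epsilon}}$ for all $f\in\mathcal H_{\tilde k_\epsilon}$.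
   Context: For $\mathbf x,\mathbf y\in\mathcal M$, the Gaussian kernel is $\tilde k_\epsilon(\mathbf x,\mathbf y)=\exp\left(-\frac{\|\mathbf x-\mathbf y\|^2}{4\epsilon}\right)$ with $\|\cdot\|$ the Euclidean norm of $\mathbb R^n$, and the Diffusion Maps kernel is defined by $$q_{\epsilon,N}(\mathbf x)=\frac1N\sum_{j=1}^N\tilde k_\epsilon(\mathbf x,\mathbf x_j),\quad \hat k_{\epsilon,N}(\mathbf x,\mathbf y)=\frac{\tilde k_\epsilon(\mathbf x,\mathbf y)}{q_{\epsilon,N}(\mathbf x)q_{\epsilon,N}(\mathbf y)},\quad \hat q_{\epsilon,N}(\mathbf x)=\frac1N\sum_{j=1}^N\hat k_{\epsilon,N}(\mathbf x,\mathbf x_j),\quad k_{\epsilon,N}(\mathbf x,\mathbf y)=\frac{\hat k_{\epsilon,N}(\mathbf x,\mathbf y)}{\sqrt{\hat q_{\epsilon,N}(\mathbf x)\hat q_{\epsilon,N}(\mathbf y)}}.$$ $\mathcal H_{\epsilon,N}$ and $\mathcal H_{\tilde k_\epsilon}$ denote the reproducing kernel Hilbert spaces of functions on $\mathcal M$ with kernels $k_{\epsilon,N}$ and $\tilde k_\epsilon$ respectively. *)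

(* Defs.v *)
(* MathComp-Analysis; R : realType is an arbitrary copy of the real numbers. *)
From HB Require Import structures.
From mathcomp Require Export all_boot all_order all_algebra.
From mathcomp Require Export all_classical all_reals all_analysis.
Export Order.TTheory GRing.Theory Num.Theory.
Export numFieldNormedType.Exports.

Set Implicit Arguments.
Unset Strict Implicit.
Unset Printing Implicit Defensive.

Local Open Scope classical_set_scope.
Local Open Scope ring_scope.

(* The library norm of 'rV[R]_n is the sup norm, with the same topology;
   metric notions need the Euclidean norm. *)
Definition enorm (R : realType) (n : nat) (v : 'rV[R]_n) : R :=
  Num.sqrt (\sum_(i < n) v ord0 i ^+ 2).

Section Submanifold.
Variables (R : realType) (n : nat).

(* C^k maps on an open set U, through iterated directional derivatives. *)
Fixpoint Ck_on (k : nat) (U : set 'rV[R]_n) (f : 'rV[R]_n -> 'rV[R]_n) : Prop :=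
  (forall x, U x -> {for x, continuous f}) /\
  if k is k'.+1 then
    forall v : 'rV[R]_n,
      (forall x, U x -> derivable f x v) /\ Ck_on k' U (fun x => 'D_v f x)
  else True.

Definition smooth_on (U : set 'rV[R]_n) (f : 'rV[R]_n -> 'rV[R]_n) : Prop :=
  forall k, Ck_on k U f.

(* Slice charts: near each of its points, M is mapped onto an open piece of
   R^d x {0} by a smooth diffeomorphism f between open subsets of R^n. *)
Definition submanifold (d : nat) (M : set 'rV[R]_n) : Prop :=
  (d <= n)%N /\
  forall p, M p ->
    exists (U : set 'rV[R]_n) (f g : 'rV[R]_n -> 'rV[R]_n),
      [/\ open U /\ U p,
          smooth_on U f,
          open (f @` U) /\ smooth_on (f @` U) g,
          (forall x, U x -> g (f x) = x) &
          (forall x, U x ->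
             (M x <-> forall i : 'I_n, (d <= i)%N -> f x ord0 i = 0))].

(* "Closed" as in "closed manifold": compact and without boundary. *)
Definition closed_submanifold (d : nat) (M : set 'rV[R]_n) : Prop :=
  submanifold d M /\ compact M.

(* The Gaussian kernel on M, where M is coerced to the type of its points. *)
Definition gauss_kernel (M : set 'rV[R]_n) (eps : R) (x y : M) : R :=
  expR (- (enorm (\val x - \val y) ^+ 2 / (4 * eps))).

End Submanifold.

Section DiffusionMaps.
Variables (R : realType) (T : Type) (kt : T -> T -> R).
Variables (N : nat) (X : 'I_N -> T).

Definition dm_q (x : T) : R := N%:R^-1 * \sum_(j < N) kt x (X j).

Definition dm_khat (x y : T) : R := kt x y / (dm_q x * dm_q y).

Definition dm_qhat (x : T) : R := N%:R^-1 * \sum_(j < N) dm_khat x (X j).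

Definition dm_kernel (x y : T) : R :=
  dm_khat x y / Num.sqrt (dm_qhat x * dm_qhat y).

Definition dm_phi (x : T) : R := 1 / (dm_q x * Num.sqrt (dm_qhat x)).

End DiffusionMaps.

Section RKHS.
Variables (R : realType) (T : Type).

Definition sym_pos_def (k : T -> T -> R) : Prop :=
  (forall x y, k x y = k y x) /\
  (forall (m : nat) (a : 'I_m -> R) (z : 'I_m -> T),
     0 <= \sum_(i < m) \sum_(j < m) a i * a j * k (z i) (z j)).

(* A real Hilbert space whose elements are functions on T, with pointwise
   operations; ip is only meaningful on the members of hfs_set. *)
Record hilbert_fun_space := HilbertFunSpace {
  hfs_set :> set (T -> R);
  hfs_ip : (T -> R) -> (T -> R) -> R;
  hfs_norm := fun f => Num.sqrt (hfs_ip f f);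
  _ : hfs_set (fun=> 0);
  _ : forall a f g, hfs_set f -> hfs_set g -> hfs_set ((a \*o f) \+ g);
  _ : forall f g, hfs_set f -> hfs_set g -> hfs_ip f g = hfs_ip g f;
  _ : forall a f g h, hfs_set f -> hfs_set g -> hfs_set h ->
        hfs_ip ((a \*o f) \+ g) h = a * hfs_ip f h + hfs_ip g h;
  _ : forall f, hfs_set f -> 0 <= hfs_ip f f;
  _ : forall f, hfs_set f -> hfs_ip f f = 0 -> f = (fun=> 0);
  _ : forall u : nat -> T -> R, (forall i, hfs_set (u i)) ->
        (forall e, 0 < e -> exists i0, forall i j,
           (i0 <= i)%N -> (i0 <= j)%N -> hfs_norm (u i \- u j) < e) ->
        exists2 f, hfs_set f &
          (fun i => hfs_norm (u i \- f)) @ \oo --> (0 : R)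
}.

Definition is_rkhs (k : T -> T -> R) (H : hilbert_fun_space) : Prop :=
  (forall x, hfs_set H (fun y => k y x)) /\
  (forall f x, hfs_set H f -> hfs_ip H f (fun y => k y x) = f x).

Definition isometric_isomorphism (H1 H2 : hilbert_fun_space)
    (U : (T -> R) -> (T -> R)) : Prop :=
  [/\ set_bij (hfs_set H1) (hfs_set H2) U,
      (forall a f g, hfs_set H1 f -> hfs_set H1 g ->
         U ((a \*o f) \+ g) = (a \*o U f) \+ U g) &
      (forall f, hfs_set H1 f -> hfs_norm H2 (U f) = hfs_norm H1 f)].

End RKHS.

(* Main.v *)
Require Import Defs.
From mathcomp Require Import ring lra.

(** The Diffusion Maps kernel is a rescaling of the Gaussian kernel [kt] by a
    nowhere vanishing function: since the Gaussian kernel takes positive values,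
    both [dm_q] and [dm_qhat] are positive, the square root of the product
    [dm_qhat x * dm_qhat y] splits, and
    [dm_kernel x y = phi x * kt x y * phi y] ([dm_kernelE]). The three claims
    then follow from general facts about rescaled kernels.

    Rescaling preserves positive definiteness, because [phi] is absorbed by the
    coefficients of the quadratic form. The Gaussian kernel is itself, up to
    such a rescaling, the exponential of a Euclidean inner product:
    [-|x-y|^2/2 = -|x|^2/2 + <x,y> - |y|^2/2]. The powers of [<x,y>] are
    positive definite by induction on the exponent, hence so are the partial
    sums of the exponential series and their limit
    ([sym_pos_def_expR_feature], [gauss_kernel_sym_pos_def]).

    Multiplication by [phi] carries a reproducing kernel Hilbert space of a
    kernel to one of the rescaled kernel, with the inner product transported so
    that the multiplication is an isometry ([rescaled_space_rkhs]). It remains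
    to see that a kernel has only one such space ([rkhs_unique]). On finite
    combinations of kernel sections the inner product is dictated by the kernel
    through the reproducing property, and these combinations are dense
    ([rkhs_span_dense]); so a member of one space is the limit of a sequence of
    combinations that is Cauchy, with the same pointwise limit, in the other. *)

Set Implicit Arguments.
Unset Strict Implicit.
Unset Printing Implicit Defensive.

Local Open Scope classical_set_scope.
Local Open Scope ring_scope.

(** * Elementary facts about the reals *)

(** The discriminant criterion. For [C > 0] the optimal choice is [t = B / C];
    for [C = 0] the bound is linear in [t] and a large [t] forces [B = 0]. *)
Lemma sqr_le_of_quadratic (R : realFieldType) (A B C : R) : 0 <= A -> 0 <= C ->
  (forall t : R, 2 * t * B <= A + t ^+ 2 * C) -> B ^+ 2 <= A * C.
Proof.
move=> A0; rewrite le_eqVlt => /predU1P[<-|C0] q.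
  have [->|B0] := eqVneq B 0; first by rewrite expr0n mulr0.
  have := q ((A + 1) / B); rewrite mulr0 -mulrA divfK // => ?; lra.
have := q (B / C).
have -> : 2 * (B / C) * B = 2 * (B ^+ 2 / C) by field; rewrite gt_eqF.
have -> : (B / C) ^+ 2 * C = B ^+ 2 / C by field; rewrite gt_eqF.
move=> h; rewrite -ler_pdivrMr //; lra.
Qed.

Lemma cvg_of_sqr_le (R : realType) (v a : nat -> R) (l C : R) : 0 <= C ->
  (forall e, 0 < e -> exists i0, forall i, (i0 <= i)%N -> a i < e) ->
  (forall i, (v i - l) ^+ 2 <= a i * C) -> v @ \oo --> l.
Proof.
move=> C0 a0 va; apply/cvgrPdist_lt => e e0.
(* [C] may vanish, so the tolerance is divided by [C + 1] *)
have C1 : 0 < C + 1 by lra.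
have [i0 Hi0] := a0 _ (divr_gt0 (exprn_gt0 2 e0) C1).
exists i0 => // i /= /Hi0; rewrite ltr_pdivlMr // => aC.
rewrite distrC -(ger0_norm (ltW e0)) -ltr_sqr ?nnegrE //.
rewrite !real_normK ?num_real //.
apply: le_lt_trans (va i) _.
have [ai0|ai0] := leP 0 (a i); first by apply: le_lt_trans aC; lra.
by apply: le_lt_trans (exprn_gt0 2 e0); rewrite mulr_le0_ge0 // ltW.
Qed.

Lemma mean_gt0 (R : numFieldType) (N : nat) (N0 : (0 < N)%N) (F : 'I_N -> R) :
  (forall j, 0 < F j) -> 0 < N%:R^-1 * \sum_(j < N) F j.
Proof.
move=> F0; rewrite mulr_gt0 ?invr_gt0 ?ltr0n //.
rewrite (bigD1 (Ordinal N0)) //= ltr_pwDl //.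
by apply: sumr_ge0 => j _; exact: ltW.
Qed.

(** * Positive definiteness of the Gaussian kernel *)

Section PositiveDefinite.
Variables (R : realType) (T : Type).
Implicit Types (k : T -> T -> R) (phi : T -> R).

Definition rescaled_kernel phi k (x y : T) : R := phi x * k x y * phi y.

Lemma sym_pos_def_rescaled phi k :
  sym_pos_def k -> sym_pos_def (rescaled_kernel phi k).
Proof.
move=> [ks kp]; split=> [x y|m a z]; first by rewrite /rescaled_kernel ks; ring.
have := kp m (fun i => a i * phi (z i)) z.
congr (0 <= _); apply: eq_bigr => i _; apply: eq_bigr => j _.
by rewrite /rescaled_kernel; ring.
Qed.

Lemma sym_pos_defZD (c : R) k1 k2 : 0 <= c ->
  sym_pos_def k1 -> sym_pos_def k2 ->
  sym_pos_def (fun x y => k1 x y + c * k2 x y).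
Proof.
move=> c0 [s1 p1] [s2 p2]; split=> [x y|m a z]; first by rewrite s1 s2.
have -> : \sum_(i < m) \sum_(j < m)
      a i * a j * (k1 (z i) (z j) + c * k2 (z i) (z j)) =
    \sum_(i < m) \sum_(j < m) a i * a j * k1 (z i) (z j) +
    c * \sum_(i < m) \sum_(j < m) a i * a j * k2 (z i) (z j).
  rewrite mulr_sumr -big_split; apply: eq_bigr => i _.
  rewrite mulr_sumr -big_split; apply: eq_bigr => j _ /=; ring.
by rewrite addr_ge0 // mulr_ge0.
Qed.

Lemma sym_pos_def_cvg (kn : nat -> T -> T -> R) k :
  (forall n, sym_pos_def (kn n)) ->
  (forall x y, (fun n => kn n x y) @ \oo --> k x y) -> sym_pos_def k.
Proof.
move=> knP cvk; split=> [x y|m a z].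
  rewrite -(cvg_lim (@Rhausdorff R) (cvk x y)).
  rewrite -(cvg_lim (@Rhausdorff R) (cvk y x)).
  by congr (limn _); apply/funext => n; have [] := knP n.
have /cvgr_to_ge : (fun n =>
    \sum_(i < m) \sum_(j < m) a i * a j * kn n (z i) (z j)) @ \oo -->
    \sum_(i < m) \sum_(j < m) a i * a j * k (z i) (z j).
  apply: cvg_big => [|i _]; first exact: add_continuous.
  apply: cvg_big => [|j _]; first exact: add_continuous.
  by apply: cvgM; [exact: cvg_cst|exact: cvk].
by apply; near=> n; have [_] := knP n; apply.
Unshelve. all: by end_near. Qed.

Definition feature_kernel (p : nat) (F : 'I_p -> T -> R) (x y : T) : R :=
  \sum_(l < p) F l x * F l y.

(** A special case of the Schur product theorem: expanding one factor of
    [(\sum_l F l x * F l y) ^+ e.+1] gives one quadratic form of exponent [e]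
    for each [l], with coefficients [a i * F l (z i)]. *)
Lemma sym_pos_def_feature_exp p (F : 'I_p -> T -> R) (e : nat) :
  sym_pos_def (fun x y => feature_kernel F x y ^+ e).
Proof.
split=> [x y|m].
  by congr (_ ^+ _); apply: eq_bigr => l _; rewrite mulrC.
elim: e => [|e IH] a z.
  have -> : \sum_(i < m) \sum_(j < m)
      a i * a j * feature_kernel F (z i) (z j) ^+ 0 = (\sum_(i < m) a i) ^+ 2.
    rewrite expr2 mulr_suml; apply: eq_bigr => i _.
    by rewrite mulr_sumr; apply: eq_bigr => j _; rewrite expr0 mulr1.
  exact: sqr_ge0.
have -> : \sum_(i < m) \sum_(j < m)
      a i * a j * feature_kernel F (z i) (z j) ^+ e.+1 =
    \sum_(l < p) \sum_(i < m) \sum_(j < m)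
      (a i * F l (z i)) * (a j * F l (z j)) *
      feature_kernel F (z i) (z j) ^+ e.
  rewrite [RHS]exchange_big /=; apply: eq_bigr => i _.
  rewrite [RHS]exchange_big /=; apply: eq_bigr => j _.
  rewrite exprS {1}/feature_kernel mulr_suml mulr_sumr; apply: eq_bigr => l _.
  ring.
by apply: sumr_ge0 => l _; apply: IH.
Qed.

Lemma sym_pos_def_expR_feature p (F : 'I_p -> T -> R) :
  sym_pos_def (fun x y => expR (feature_kernel F x y)).
Proof.
apply: (@sym_pos_def_cvg
  (fun n x y => series (exp_coeff (feature_kernel F x y)) n)); last first.
  by move=> x y; apply: is_cvg_series_exp_coeff.
elim=> [|n IH].
  split=> [x y|m a z]; first by rewrite !seriesEnat /= !big_geq.
  rewrite big1 // => i _; rewrite big1 // => j _.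
  by rewrite seriesEnat /= big_geq // mulr0.
have -> : (fun x y => series (exp_coeff (feature_kernel F x y)) n.+1) =
    (fun x y => series (exp_coeff (feature_kernel F x y)) n +
                n`!%:R^-1 * feature_kernel F x y ^+ n).
  apply/funext => x; apply/funext => y.
  by rewrite !seriesEnat /= big_nat_recr //= [X in _ + X]mulrC.
apply: (sym_pos_defZD _ IH); first by rewrite invr_ge0.
exact: sym_pos_def_feature_exp.
Qed.

End PositiveDefinite.

(** * Hilbert spaces of functions *)

Section HilbertFunctionSpace.
Variables (R : realType) (T : Type) (H : hilbert_fun_space R T).
Implicit Types (f g h : T -> R) (u : nat -> T -> R).
Local Notation ip := (hfs_ip H).

Lemma hfs0 : hfs_set H (fun=> 0). Proof. by case: H. Qed.

Lemma hfsZD (a : R) f g :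
  hfs_set H f -> hfs_set H g -> hfs_set H ((a \*o f) \+ g).
Proof. case: H => /= *; auto. Qed.

Lemma hfs_ipC f g : hfs_set H f -> hfs_set H g -> ip f g = ip g f.
Proof. case: H => /= *; auto. Qed.

Lemma hfs_ipZDl (a : R) f g h : hfs_set H f -> hfs_set H g -> hfs_set H h ->
  ip ((a \*o f) \+ g) h = a * ip f h + ip g h.
Proof. case: H => /= *; auto. Qed.

Lemma hfs_ip_ge0 f : hfs_set H f -> 0 <= ip f f.
Proof. case: H => /= *; auto. Qed.

Lemma hfs_ip_eq0 f : hfs_set H f -> ip f f = 0 -> f = (fun=> 0).
Proof. case: H => /= *; auto. Qed.

Lemma subf_ZD f g : f \- g = ((-1) \*o g) \+ f.
Proof. by apply/funext => x /=; ring. Qed.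

Lemma hfsB f g : hfs_set H f -> hfs_set H g -> hfs_set H (f \- g).
Proof. by move=> *; rewrite subf_ZD; apply: hfsZD. Qed.

Lemma hfs_ipBl f g h : hfs_set H f -> hfs_set H g -> hfs_set H h ->
  ip (f \- g) h = ip f h - ip g h.
Proof. by move=> *; rewrite subf_ZD hfs_ipZDl //; ring. Qed.

Lemma hfs_ipZDZD (a : R) f g : hfs_set H f -> hfs_set H g ->
  ip ((a \*o f) \+ g) ((a \*o f) \+ g) =
  a ^+ 2 * ip f f + 2 * a * ip f g + ip g g.
Proof.
move=> Hf Hg; have HZD := hfsZD a Hf Hg.
rewrite hfs_ipZDl // (hfs_ipC Hf) // (hfs_ipC Hg) // !hfs_ipZDl //.
by rewrite (hfs_ipC Hg Hf); ring.
Qed.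

Lemma hfs_ipBB f g : hfs_set H f -> hfs_set H g ->
  ip (f \- g) (f \- g) = ip f f - 2 * ip f g + ip g g.
Proof.
by move=> Hf Hg; rewrite subf_ZD hfs_ipZDZD // (hfs_ipC Hg Hf); ring.
Qed.

Lemma hfs_ipZDr (a : R) f g h : hfs_set H f -> hfs_set H g -> hfs_set H h ->
  ip h ((a \*o f) \+ g) = a * ip h f + ip h g.
Proof.
move=> Hf Hg Hh; have HZD := hfsZD a Hf Hg.
by rewrite (hfs_ipC Hh HZD) hfs_ipZDl // !(hfs_ipC Hh).
Qed.

Lemma hfs_ip0r f : hfs_set H f -> ip f (fun=> 0) = 0.
Proof.
move=> Hf; have /= := hfs_ipBl hfs0 hfs0 Hf.
rewrite subrr (hfs_ipC Hf hfs0) => ip0; rewrite -[RHS]ip0.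
by congr (ip _ f); apply/funext => x /=; rewrite subr0.
Qed.

(** Convergence and the Cauchy property are stated with the squared norm, which
    is the quantity that bilinearity computes. *)
Definition hfs_cvg u f := forall e : R, 0 < e ->
  exists i0, forall i, (i0 <= i)%N -> ip (u i \- f) (u i \- f) < e.

Definition hfs_cauchy u := forall e : R, 0 < e ->
  exists i0, forall i j, (i0 <= i)%N -> (i0 <= j)%N ->
    ip (u i \- u j) (u i \- u j) < e.

Lemma hfs_norm_lt f (e : R) : 0 < e -> (hfs_norm H f < e) = (ip f f < e ^+ 2).
Proof.
move=> e0; rewrite /hfs_norm -[X in _ < X](ger0_norm (ltW e0)) -sqrtr_sqr.
by rewrite ltr_sqrt // exprn_gt0.
Qed.

Lemma hfs_complete u : (forall i, hfs_set H (u i)) -> hfs_cauchy u ->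
  exists2 f, hfs_set H f & hfs_cvg u f.
Proof.
move=> Hu Cu.
have [f Hf uf] : exists2 f, hfs_set H f &
    (fun i => hfs_norm H (u i \- f)) @ \oo --> (0 : R).
  have Cu' : forall e, 0 < e -> exists i0, forall i j,
    (i0 <= i)%N -> (i0 <= j)%N -> hfs_norm H (u i \- u j) < e.
    move=> e e0; have [i0 Hi0] := Cu _ (exprn_gt0 2 e0).
    by exists i0 => i j li lj; rewrite hfs_norm_lt //; apply: Hi0.
  move: Hu Cu'; clear; case: H => /= ? ? ? ? ? ? ? ? hc; exact: hc.
exists f => // e e0.
have s0 : 0 < Num.sqrt e by rewrite sqrtr_gt0.
have /cvgrPdist_lt /(_ _ s0)[i0 _ Hi0] := uf.
exists i0 => i /Hi0 /=; rewrite sub0r normrN ger0_norm ?sqrtr_ge0 //.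
by rewrite hfs_norm_lt // sqr_sqrtr // ltW.
Qed.

Lemma hfs_cvg_cauchy u f : (forall i, hfs_set H (u i)) -> hfs_set H f ->
  hfs_cvg u f -> hfs_cauchy u.
Proof.
move=> Hu Hf uf e e0; have [|i0 Hi0] := uf (e / 4); first by lra.
exists i0 => i j /Hi0 ui /Hi0 uj.
have HB i' := hfsB (Hu i') Hf.
have -> : u i \- u j = (u i \- f) \- (u j \- f).
  by apply/funext => x /=; ring.
(* by the parallelogram law, [|u i - u j|^2] is at most
   [2 |u i - f|^2 + 2 |u j - f|^2] *)
have := hfs_ip_ge0 (hfsZD 1 (HB i) (HB j)).
rewrite hfs_ipBB // hfs_ipZDZD // => p; lra.
Qed.

Lemma hfs_cauchy_schwarz f g : hfs_set H f -> hfs_set H g ->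
  ip f g ^+ 2 <= ip f f * ip g g.
Proof.
move=> Hf Hg; apply: sqr_le_of_quadratic; try exact: hfs_ip_ge0.
move=> t; have := hfs_ip_ge0 (hfsZD (- t) Hg Hf).
by rewrite hfs_ipZDZD // (hfs_ipC Hg Hf) => ?; nra.
Qed.

End HilbertFunctionSpace.

(** * Density of the kernel sections *)

Section KernelSpan.
Variables (R : realType) (T : Type) (k : T -> T -> R).
Implicit Types (f g s t : T -> R) (u : nat -> T -> R).

Inductive kernel_span : (T -> R) -> Prop :=
| kernel_span0 : kernel_span (fun=> 0)
| kernel_spanZD (a : R) (x : T) g :
    kernel_span g -> kernel_span ((a \*o (fun y => k y x)) \+ g).

Lemma kernel_span_kernel x : kernel_span (fun y => k y x).
Proof.
congr (kernel_span _): (kernel_spanZD 1 x kernel_span0).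
by apply/funext => y /=; ring.
Qed.

Lemma kernel_span_comb (a : R) s t :
  kernel_span s -> kernel_span t -> kernel_span ((a \*o s) \+ t).
Proof.
move=> Ks Kt; elim: Ks => [|b x g _ IH].
  by congr (kernel_span _): Kt; apply/funext => y /=; ring.
congr (kernel_span _): (kernel_spanZD (a * b) x IH).
by apply/funext => y /=; ring.
Qed.

Section Reproducing.
Variables (H : hilbert_fun_space R T) (kH : is_rkhs k H).
Local Notation ip := (hfs_ip H).

Lemma kernel_span_hfs s : kernel_span s -> hfs_set H s.
Proof.
by elim=> [|a x g _ IH]; [exact: hfs0|apply: hfsZD => //; exact: kH.1].
Qed.

Lemma rkhs_eval_bound f x : hfs_set H f -> f x ^+ 2 <= ip f f * k x x.
Proof.
move=> Hf; have := hfs_cauchy_schwarz Hf (kH.1 x).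
by rewrite kH.2 // kH.2 //; exact: kH.1.
Qed.

Lemma rkhs_kernel_ge0 x : 0 <= k x x.
Proof. by rewrite -(kH.2 _ x (kH.1 x)); exact/hfs_ip_ge0/kH.1. Qed.

Lemma rkhs_cvg_eval u f x : (forall i, hfs_set H (u i)) -> hfs_set H f ->
  hfs_cvg H u f -> (fun i => u i x) @ \oo --> f x.
Proof.
move=> Hu Hf uf; apply: (cvg_of_sqr_le (rkhs_kernel_ge0 x) uf) => i.
exact: rkhs_eval_bound (hfsB (Hu i) Hf).
Qed.

(** An approximate orthogonal projection of [f] onto the span: if the squared
    distance from [f] to [s] exceeds the infimum by at most [d], then moving
    [s] along [t] can decrease it by at most [d], and the discriminant of the
    resulting quadratic inequality is the stated bound. *)
Lemma rkhs_almost_orthogonal f (d : R) : hfs_set H f -> 0 < d ->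
  exists2 s, kernel_span s & forall t, kernel_span t ->
    ip (f \- s) t ^+ 2 <= d * ip t t.
Proof.
move=> Hf d0.
pose E := [set ip (f \- s) (f \- s) | s in kernel_span].
have E0 : lbound E 0.
  by move=> _ [s /kernel_span_hfs Hs <-]; apply/hfs_ip_ge0/hfsB.
have hE : has_inf E.
  by split; [exists (ip (f \- (fun=> 0)) (f \- (fun=> 0))), (fun=> 0) => //;
     exact: kernel_span0 | exists 0].
have [_ [s Ks <-] hs] := inf_adherent d0 hE.
have Hs := kernel_span_hfs Ks; exists s => // t Kt.
have Ht := kernel_span_hfs Kt; have Hfs := hfsB Hf Hs.
apply: sqr_le_of_quadratic; [exact: ltW|exact: hfs_ip_ge0|move=> r].
have : inf E <= ip (f \- ((r \*o t) \+ s)) (f \- ((r \*o t) \+ s)).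
  by apply: ge_inf; [exists 0|exists ((r \*o t) \+ s) => //;
     exact: kernel_span_comb].
have -> : f \- ((r \*o t) \+ s) = ((- r) \*o t) \+ (f \- s).
  by apply/funext => y /=; ring.
rewrite hfs_ipZDZD // (hfs_ipC Ht Hfs) => h; nra.
Qed.

(** Approximate projections [u i] of [f], with tolerances tending to [0], form
    a Cauchy sequence because the difference of two of them lies in the span,
    to which both residuals are almost orthogonal. Testing the residual against
    a kernel section shows that [u i x] tends to [f x]; as evaluation is
    continuous, the limit of the sequence is [f]. *)
Lemma rkhs_span_dense f : hfs_set H f ->
  exists2 u, (forall i, kernel_span (u i)) & hfs_cvg H u f.
Proof.
move=> Hf.
have ex i : exists s, kernel_span s /\ forall t, kernel_span t ->
    ip (f \- s) t ^+ 2 <= i.+1%:R^-1 * ip t t.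
  have [|s Ks hs] := rkhs_almost_orthogonal Hf (_ : 0 < i.+1%:R^-1).
    by rewrite invr_gt0.
  by exists s.
have [u /all_and2[Ku hu]] := choice ex.
have Hu i := kernel_span_hfs (Ku i).
exists u => //.
have small (e : R) : 0 < e ->
    exists i0, forall i, (i0 <= i)%N -> i.+1%:R^-1 < e.
  move=> e0; have [i0 _ Hi0] := near_infty_natSinv_lt (PosNum e0).
  by exists i0 => i /Hi0.
have KB i j : kernel_span (u i \- u j).
  by rewrite subf_ZD; exact: kernel_span_comb.
have Cu : hfs_cauchy H u.
  move=> e e0; have [|i0 Hi0] := small (e / 4); first by lra.
  exists i0 => i j /Hi0 li /Hi0 lj; set v := u i \- u j.
  have Hv : hfs_set H v by exact: hfsB.
  have vE : ip v v = ip (f \- u j) v - ip (f \- u i) v.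
    rewrite -hfs_ipBl //; try exact: hfsB.
    by congr (ip _ v); apply/funext => x /=; rewrite /v /=; ring.
  have ha := hu j _ (KB i j); have hb := hu i _ (KB i j).
  set di := i.+1%:R^-1 in li hb; set dj := j.+1%:R^-1 in lj ha.
  have w0 := hfs_ip_ge0 Hv; rewrite -/v in ha hb.
  set w := ip v v in vE ha hb w0 *; set a := ip _ v in vE ha.
  set b := ip _ v in vE hb.
  (* [w = a - b] with [a^2 <= dj * w] and [b^2 <= di * w], hence
     [w^2 <= 2 * a^2 + 2 * b^2 <= 2 * (di + dj) * w] *)
  rewrite ltNge; apply/negP => ew.
  have w_gt0 : 0 < w := lt_le_trans e0 ew.
  have : w * w <= (2 * (di + dj)) * w.
    have wE : w * w = 2 * a ^+ 2 + 2 * b ^+ 2 - (a + b) ^+ 2.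
      by rewrite vE; ring.
    have := sqr_ge0 (a + b); lra.
  rewrite ler_pM2r //; lra.
have [g Hg ug] := hfs_complete Hu Cu.
suff -> : f = g by [].
apply/funext => x.
have gx := rkhs_cvg_eval (x := x) Hu Hg ug.
suff fx : (fun i => u i x) @ \oo --> f x.
  by rewrite -(cvg_lim (@Rhausdorff R) fx) (cvg_lim (@Rhausdorff R) gx).
apply: (cvg_of_sqr_le (rkhs_kernel_ge0 x) small) => i.
have Hfu := hfsB Hf (Hu i).
have := hu i _ (kernel_span_kernel x).
by rewrite (kH.2 _ _ Hfu) (kH.2 _ _ (kH.1 x)) /= -sqrrN opprB.
Qed.

End Reproducing.

End KernelSpan.

(** * Uniqueness of the reproducing kernel Hilbert space *)

Section Uniqueness.
Variables (R : realType) (T : Type) (k : T -> T -> R).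
Implicit Types (H : hilbert_fun_space R T) (f s : T -> R).

Lemma rkhs_ip_span H H' f s : is_rkhs k H -> is_rkhs k H' ->
  hfs_set H f -> hfs_set H' f -> kernel_span k s ->
  hfs_ip H f s = hfs_ip H' f s.
Proof.
move=> kH kH' Hf Hf'; elim=> [|a x g Kg IH]; first by rewrite !hfs_ip0r.
have Hg := kernel_span_hfs kH Kg; have Hg' := kernel_span_hfs kH' Kg.
have Hk := kH.1 x; have Hk' := kH'.1 x.
by rewrite !hfs_ipZDr // kH.2 // kH'.2 // IH.
Qed.

Lemma rkhs_subset H H' : is_rkhs k H -> is_rkhs k H' ->
  hfs_set H `<=` hfs_set H'.
Proof.
move=> kH kH' f Hf.
have [u Ku uf] := rkhs_span_dense kH Hf.
have Hu i := kernel_span_hfs kH (Ku i).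
have Hu' i := kernel_span_hfs kH' (Ku i).
have Cu' : hfs_cauchy H' u.
  move=> e e0; have [i0 Hi0] := hfs_cvg_cauchy Hu Hf uf e0.
  exists i0 => i j li lj.
  have KB : kernel_span k (u i \- u j).
    by rewrite subf_ZD; exact: kernel_span_comb.
  rewrite -(rkhs_ip_span kH kH') //; first exact: Hi0.
  - exact: hfsB.
  - exact: hfsB.
have [g Hg ug] := hfs_complete Hu' Cu'.
suff -> : f = g by [].
apply/funext => x.
have fx := rkhs_cvg_eval kH (x := x) Hu Hf uf.
have gx := rkhs_cvg_eval kH' (x := x) Hu' Hg ug.
by rewrite -(cvg_lim (@Rhausdorff R) fx) (cvg_lim (@Rhausdorff R) gx).
Qed.

(** For [s] in the span, [2 * ip f s - ip s s] is the same in both spaces. It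
    is at most [ip f f] in either one, and falls short of it by exactly
    [ip (s - f) (s - f)], which density makes arbitrarily small in [H]. *)
Lemma rkhs_ip_le H H' f : is_rkhs k H -> is_rkhs k H' ->
  hfs_set H f -> hfs_set H' f -> hfs_ip H f f <= hfs_ip H' f f.
Proof.
move=> kH kH' Hf Hf'; apply/ler_addgt0Pr => e e0.
have [u Ku uf] := rkhs_span_dense kH Hf.
have [i0 /(_ i0 (leqnn _))] := uf e e0.
have Hu := kernel_span_hfs kH (Ku i0).
have Hu' := kernel_span_hfs kH' (Ku i0).
have := hfs_ip_ge0 (hfsB Hu' Hf').
rewrite !hfs_ipBB // (hfs_ipC Hu Hf) (hfs_ipC Hu' Hf').
rewrite (rkhs_ip_span kH kH' Hf Hf') // (rkhs_ip_span kH kH' Hu Hu') //.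
lra.
Qed.

Lemma rkhs_unique H H' : is_rkhs k H -> is_rkhs k H' ->
  hfs_set H = hfs_set H' /\
  (forall f, hfs_set H f -> hfs_norm H f = hfs_norm H' f).
Proof.
move=> kH kH'; split=> [|f Hf].
  by apply/seteqP; split; exact: rkhs_subset.
have Hf' := rkhs_subset kH kH' Hf.
congr (Num.sqrt _); apply: le_anti.
by rewrite !rkhs_ip_le.
Qed.

End Uniqueness.

(** * Rescaling by a nowhere vanishing function *)

Section RescaledSpace.
Variables (R : realType) (T : Type) (phi : T -> R).
Hypothesis phi0 : forall x, phi x != 0.
Variable H : hilbert_fun_space R T.
Implicit Types (f g : T -> R).

Definition unscale f : T -> R := fun x => f x / phi x.

Lemma unscaleK f : phi \* unscale f = f.
Proof. by apply/funext => x /=; rewrite /unscale mulrC divfK. Qed.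

Lemma scaleK f : unscale (phi \* f) = f.
Proof. by apply/funext => x; rewrite /unscale /= mulrC mulKf. Qed.

Lemma unscaleZD (a : R) f g :
  unscale ((a \*o f) \+ g) = (a \*o unscale f) \+ unscale g.
Proof. by apply/funext => x; rewrite /unscale /= mulrDl mulrA. Qed.

Lemma unscale0 : unscale (fun=> 0) = (fun=> 0).
Proof. by apply/funext => x; rewrite /unscale mul0r. Qed.

Lemma unscaleB f g : unscale (f \- g) = unscale f \- unscale g.
Proof. by apply/funext => x; rewrite /unscale /= mulrBl. Qed.

Definition rescaled_space : hilbert_fun_space R T.
Proof.
refine (@HilbertFunSpace R T [set f | hfs_set H (unscale f)]
  (fun f g => hfs_ip H (unscale f) (unscale g)) _ _ _ _ _ _ _) => /=.
- by rewrite unscale0; exact: hfs0.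
- by move=> a f g Hf Hg; rewrite unscaleZD; exact: hfsZD.
- by move=> f g; exact: hfs_ipC.
- by move=> a f g h Hf Hg Hh; rewrite unscaleZD hfs_ipZDl.
- by move=> f; exact: hfs_ip_ge0.
- move=> f Hf /(hfs_ip_eq0 Hf) f0; rewrite -(unscaleK f) f0.
  by apply/funext => x /=; rewrite mulr0.
- move=> u Hu Cu.
  have Cu' : hfs_cauchy H (fun i => unscale (u i)).
    move=> e e0; have [|i0 Hi0] := Cu (Num.sqrt e); first by rewrite sqrtr_gt0.
    exists i0 => i j li lj; have := Hi0 i j li lj.
    by rewrite unscaleB ltr_sqrt.
  have [g Hg ug] := hfs_complete Hu Cu'.
  exists (phi \* g); rewrite ?scaleK //.
  apply/cvgrPdist_lt => e e0.
  have [i0 Hi0] := ug _ (exprn_gt0 2 e0).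
  exists i0 => // i /= li; rewrite sub0r normrN ger0_norm ?sqrtr_ge0 //.
  by rewrite unscaleB scaleK -/(hfs_norm H _) hfs_norm_lt //; exact: Hi0.
Defined.

Lemma rescaled_space_rkhs k :
  is_rkhs k H -> is_rkhs (rescaled_kernel phi k) rescaled_space.
Proof.
move=> kH.
have kE x : unscale (fun y => rescaled_kernel phi k y x) =
    (phi x \*o (fun y => k y x)) \+ (fun=> 0).
  apply/funext => y; rewrite /unscale /rescaled_kernel /= addr0.
  by field; exact: phi0.
have Hk x := hfsZD (phi x) (kH.1 x) (hfs0 H).
split=> [x|f x Hf] /=; rewrite kE //.
rewrite hfs_ipZDr //; [|exact: kH.1|exact: hfs0].
by rewrite kH.2 // hfs_ip0r // addr0 /unscale mulrC divfK.
Qed.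

End RescaledSpace.

(** By uniqueness it is enough to look at the transported space, for which the
    image and the norm identities hold by construction. *)
Lemma rescaled_rkhs_isometry (R : realType) (T : Type) (phi : T -> R)
    (k : T -> T -> R) (H H' : hilbert_fun_space R T) :
  (forall x, phi x != 0) -> is_rkhs k H -> is_rkhs (rescaled_kernel phi k) H' ->
  hfs_set H' = [set phi \* f | f in hfs_set H] /\
  isometric_isomorphism H H' (fun f => phi \* f).
Proof.
move=> phi0 kH kH'.
have [setE normE] := rkhs_unique (rescaled_space_rkhs phi0 kH) kH'.
have H'E : hfs_set H' = [set phi \* f | f in hfs_set H].
  rewrite -setE; apply/seteqP; split=> [f /= Hf|_ [f Hf <-]] /=.
    by exists (unscale phi f) => //; rewrite unscaleK.
  by rewrite scaleK.
split=> //; split=> [|a f g _ _|f Hf].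
- split=> [f Hf|f g _ _ fg|f].
  + by rewrite H'E; exists f.
  + by rewrite -(scaleK phi0 f) fg scaleK.
  + by rewrite H'E.
- by apply/funext => x /=; ring.
- by rewrite -normE /= ?scaleK // /hfs_norm /= scaleK.
Qed.

(** * The Diffusion Maps kernel *)

Lemma gauss_kernel_sym_pos_def (R : realType) (n : nat) (M : set 'rV[R]_n)
    (eps : R) : 0 < eps -> sym_pos_def (@gauss_kernel R n M eps).
Proof.
move=> eps0; pose c := Num.sqrt (2 * eps).
have c2 : c ^+ 2 = 2 * eps by rewrite sqr_sqrtr //; lra.
have c0 : c != 0 by rewrite gt_eqF // sqrtr_gt0; lra.
(* dividing the coordinates by [c] turns the exponent into [- |x - y|^2 / 2],
   whose cross term is the inner product of the features *)
pose F (l : 'I_n) (x : M) : R := \val x ord0 l / c.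
pose phi (x : M) : R := expR (- (\sum_(l < n) F l x ^+ 2) / 2).
suff -> : @gauss_kernel R n M eps =
    rescaled_kernel phi (fun x y => expR (feature_kernel F x y)).
  exact/sym_pos_def_rescaled/sym_pos_def_expR_feature.
apply/funext => x; apply/funext => y.
rewrite /gauss_kernel /rescaled_kernel /phi -!expRD; congr expR.
rewrite /enorm sqr_sqrtr; last by apply: sumr_ge0 => l _; exact: sqr_ge0.
rewrite /feature_kernel !mulr_suml -!sumrN !mulr_suml -!big_split /=.
apply: eq_bigr => l _; rewrite !mxE /F.
have -> : 4 * eps = 2 * c ^+ 2 by rewrite c2; ring.
by field.
Qed.

Section DiffusionMapsKernel.
Variables (R : realType) (T : Type) (k : T -> T -> R).
Variables (N : nat) (X : 'I_N -> T).
Hypotheses (N0 : (0 < N)%N) (k0 : forall x y, 0 < k x y).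

Lemma dm_kernelE : dm_kernel k X = rescaled_kernel (dm_phi k X) k.
Proof.
have q0 x : 0 < dm_q k X x by apply: mean_gt0.
have qh0 x : 0 < dm_qhat k X x.
  by apply: mean_gt0 => // j; rewrite divr_gt0 // mulr_gt0.
apply/funext => x; apply/funext => y.
rewrite /dm_kernel /dm_khat /rescaled_kernel /dm_phi sqrtrM ?ltW //.
by field; rewrite !gt_eqF ?sqrtr_gt0.
Qed.

End DiffusionMapsKernel.

Unset Implicit Arguments.

Theorem lemma4p1 (R : realType) (n d : nat) (M : set 'rV[R]_n)
    (hM : closed_submanifold d M)
    (N : nat) (hN : (0 < N)%N) (X : 'I_N -> M)
    (eps : R) (heps : 0 < eps)
    (hphi : forall x : M, dm_phi (gauss_kernel eps) X x != 0) :
  let kt : M -> M -> R := gauss_kernel eps in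
  let k : M -> M -> R := dm_kernel kt X in
  let U : (M -> R) -> (M -> R) := fun f => dm_phi kt X \* f in
  sym_pos_def k /\
  forall Ht : hilbert_fun_space R M, is_rkhs kt Ht ->
    (exists H : hilbert_fun_space R M, is_rkhs k H) /\
    (forall H : hilbert_fun_space R M, is_rkhs k H ->
       hfs_set H = [set U f | f in hfs_set Ht] /\
       isometric_isomorphism Ht H U).
Proof.
move=> kt k U.
have kE : k = rescaled_kernel (dm_phi kt X) kt.
  by apply: dm_kernelE => // x y; exact: expR_gt0.
rewrite kE; split; first exact/sym_pos_def_rescaled/gauss_kernel_sym_pos_def.
move=> Ht ktHt; split=> [|H]; last exact: rescaled_rkhs_isometry.
by exists (rescaled_space hphi Ht); exact: rescaled_space_rkhs.
Qed.
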